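(* Let $N\ge 0$ be an integer and let the $q$-hypergeometric Euler numbers of the second kind $\widehat{\mathcal E}_{N,k}$ be defined by $\sum_{k=0}^\infty\widehat{\mathcal E}_{N,k}\frac{x^k}{k!}=\left(\sum_{n=0}^\infty\frac{[2N+1]_q!\,x^{2n}}{[2N+2n+1]_q!}\right)^{-1}$. Then, as formal power series in $x$, $$\sum_{k=0}^\infty\widehat{\mathcal E}_{N,k}\frac{x^k}{k!}=1-\cfrac{x^2}{[2N+2]_q[2N+3]_q+x^2-\cfrac{[2N+2]_q[2N+3]_q x^2}{[2N+4]_q[2N+5]_q+x^2-\cfrac{[2N+4]_q[2N+5]_q x^2}{[2N+6]_q[2N+7]_q+x^2-\ddots}}}.$$
   Context: $q\ne 1$ is a complex number that is not a root of unity; $[n]_q=\frac{1-q^n}{1-q}$, $[n]_q!=[n]_q[n-1]_q\cdots[1]_q$ for $n\ge1$, and $[0]_q!=1$. The infinite continued fraction is the limit, in the $x$-adic topology on formal power series, of its finite truncations (the $j$-th one ending with the partial denominator $[2N+2j]_q[2N+2j+1]_q+x^2$), each truncation being a rational function of $x$ expanded as a formal power series at $x=0$. *)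

(* Defs.v *)
From mathcomp Require Import all_boot all_order all_algebra.
From mathcomp Require Import reals complex.

Set Implicit Arguments.
Unset Strict Implicit.
Unset Printing Implicit Defensive.

Import GRing.Theory Num.Theory.
Local Open Scope ring_scope.

Section FormalPowerSeries.
Variable K : fieldType.

(* [s k] is the coefficient of x^k. *)
Definition fps := nat -> K.

Definition fps_mul (s t : fps) : fps :=
  fun n => \sum_(i < n.+1) s i * t (n - i)%N.

Definition fps_of_poly (p : {poly K}) : fps := fun n => p`_n.

(* The first [n] coefficients t_0, ..., t_(n-1) of the inverse of [s], given by
   t_0 = 1/s_0 and t_n = - (1/s_0) \sum_(i < n) t_i s_(n-i). *)
Fixpoint fps_inv_coefs (s : fps) (n : nat) : seq K :=
  if n is m.+1 then
    let t := fps_inv_coefs s m in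
    rcons t ((s 0%N)^-1 * ((m == 0%N)%:R - \sum_(i < m) t`_i * s (m - i)%N))
  else [::].

(* Meaningful only if [s 0 != 0]; see [fps_mulVf]. *)
Definition fps_inv (s : fps) : fps := fun n => (fps_inv_coefs s n.+1)`_n.

Lemma size_fps_inv_coefs s n : size (fps_inv_coefs s n) = n.
Proof. by elim: n => //= n IHn; rewrite size_rcons IHn. Qed.

Lemma nth_fps_inv_coefs s n i :
  (i < n)%N -> (fps_inv_coefs s n)`_i = fps_inv s i.
Proof.
elim: n => // n IHn; rewrite ltnS leq_eqVlt => /predU1P[-> // | lt_in].
by rewrite /= nth_rcons size_fps_inv_coefs lt_in IHn.
Qed.

Lemma fps_mulVf s n :
  s 0%N != 0 -> fps_mul (fps_inv s) s n = (n == 0%N)%:R.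
Proof.
move=> s0; rewrite /fps_mul big_ord_recr /= subnn {2}/fps_inv /=.
rewrite nth_rcons size_fps_inv_coefs ltnn eqxx mulrAC mulVf // mul1r.
rewrite addrC [X in _ - X](eq_bigr (fun i : 'I_n => fps_inv s i * s (n - i)%N)).
  by rewrite subrK.
by move=> i _; rewrite nth_fps_inv_coefs.
Qed.

(* The rational function [r] is regular at x = 0 and [s] is its expansion
   there. *)
Definition expansion_at0 (r : {fraction {poly K}}) (s : fps) : Prop :=
  exists n d : {poly K},
    [/\ d.[0] != 0, r = tofrac n / tofrac d
      & forall k, fps_mul s (fps_of_poly d) k = fps_of_poly n k].

(* Convergence in the x-adic topology: for every m, [s j] and [l] eventually
   agree modulo x^m. *)
Definition xadic_cvg (s : nat -> fps) (l : fps) : Prop :=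
  forall m, exists J, forall j, (J <= j)%N -> forall k, (k < m)%N -> s j k = l k.

Definition egf (a : nat -> K) : fps := fun k => a k / k`!%:R.

(* [cfrac a b i k.+1] is
   a_i / (b_i - a_(i+1) / (b_(i+1) - ... - a_(i+k) / b_(i+k))). *)
Fixpoint cfrac (F : fieldType) (a b : nat -> F) (i k : nat) : F :=
  if k is k'.+1 then a i / (b i - cfrac a b i.+1 k') else 0.

End FormalPowerSeries.

Section QEuler.
Variables (K : fieldType) (q : K).

Definition qnat (n : nat) : K := (1 - q ^+ n) / (1 - q).

Definition qfact (n : nat) : K := \prod_(1 <= i < n.+1) qnat i.

Definition qhyp_series (N : nat) : fps K := fun m =>
  if odd m then 0
  else let n := m./2 in qfact (2 * N + 1) / qfact (2 * N + 2 * n + 1).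

Definition qhyp_euler2 (N k : nat) : K :=
  k`!%:R * fps_inv (qhyp_series N) k.

Definition cf_coef (N i : nat) : K :=
  qnat (2 * N + 2 * i) * qnat (2 * N + 2 * i + 1).

(* The numerators are x^2, c_1 x^2, c_2 x^2, ... with c_i = [cf_coef N i]: the
   first one carries no factor c_0. *)
Definition cf_num (N i : nat) : {fraction {poly K}} :=
  tofrac (if i == 1%N then 'X^2 else (cf_coef N i.-1)%:P * 'X^2).

Definition cf_den (N i : nat) : {fraction {poly K}} :=
  tofrac ((cf_coef N i)%:P + 'X^2).

(* Ends with the partial denominator [cf_den N j]; equal to 1 if [j = 0]. *)
Definition cf_trunc (N j : nat) : {fraction {poly K}} :=
  1 - cfrac (cf_num N) (cf_den N) 1 j.

End QEuler.

(* In characteristic 0 the numbers [qhyp_euler2 q N k] are those whose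
   exponential generating function is the inverse of [qhyp_series q N]. *)
Lemma egf_qhyp_euler2 (K : numFieldType) (q : K) N k :
  egf (qhyp_euler2 q N) k = fps_inv (qhyp_series q N) k.
Proof.
by rewrite /egf /qhyp_euler2 mulrAC mulfV ?mul1r // pnatr_eq0 -lt0n fact_gt0.
Qed.

(* Main.v *)
Require Import Defs.
From mathcomp Require Import all_boot all_order all_algebra.
From mathcomp Require Import reals complex.
From mathcomp Require Import ring zify.

Import GRing.Theory Num.Theory.
Local Open Scope ring_scope.

(** Write c_i = [2N+2i]_q [2N+2i+1]_q.  The factorials telescope, so the series
    to be inverted is the hypergeometric-like sum
    S = \sum_n x^(2n) / (c_1 ... c_n), and the continued fraction is Euler's
    expansion of 1/S: its j-th truncation is exactly 1/S_j, with S_j the partial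
    sum over n <= j.

    To see this, put the partial sums in Horner form: if T_(i,k) denotes the sum
    over n <= k of x^(2n) / (c_i ... c_(i+n-1)), then
    T_(i,k+1) = 1 + (x^2 / c_i) T_(i+1,k).  Downward substitution of this
    recurrence shows that the denominator reached at level i of the continued
    fraction is c_i T_(i,k+1) / T_(i+1,k) ([cfrac_tail]), which at the top level
    gives 1 / T_(1,j) ([one_sub_cfrac]).  Since q is not a root of unity, no c_i
    with i >= 1 vanishes; since T_(1,j) has constant term 1, its inverse is a
    power series.  Finally, S_j and S agree below degree 2j+2, and the
    coefficients of an inverse up to degree n depend only on those of the series
    up to degree n ([eq_fps_inv]), whence the x-adic convergence. *)

Lemma eq_fps_inv_coefs (K : fieldType) (s t : fps K) n :
  (forall k, (k < n)%N -> s k = t k) -> fps_inv_coefs s n = fps_inv_coefs t n.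
Proof.
elim: n => //= n IHn eq_st.
rewrite IHn => [|k lt_kn]; last by rewrite eq_st // ltnW.
rewrite eq_st //; congr (rcons _ (_ * (_ - _))).
by apply: eq_bigr => i _; rewrite eq_st // ltnS leq_subr.
Qed.

Lemma eq_fps_inv (K : fieldType) (s t : fps K) n :
  (forall k, (k <= n)%N -> s k = t k) -> fps_inv s n = fps_inv t n.
Proof. by move=> eq_st; rewrite /fps_inv (@eq_fps_inv_coefs _ s t). Qed.

Lemma expansion_at0_inv (K : fieldType) (d : {poly K}) :
  d.[0] != 0 -> expansion_at0 (tofrac d)^-1 (fps_inv (fps_of_poly d)).
Proof.
move=> d0; exists 1, d; split=> // [|k]; first by rewrite tofrac1 div1r.
by rewrite fps_mulVf /fps_of_poly ?coef1 // -horner_coef0.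
Qed.

(** Euler's transformation over an arbitrary field.  For rational functions, z is
    x^2 and T i k is the partial sum of z^n / (c_i ... c_(i+n-1)); the recurrence
    of the sums carries the whole argument, and their not vanishing makes every
    denominator of the fraction invertible. *)
Section EulerContinuedFraction.
Variables (F : fieldType) (z : F) (c a b : nat -> F) (T : nat -> nat -> F).
Hypothesis c_neq0 : forall i, (0 < i)%N -> c i != 0.
Hypothesis T_neq0 : forall i k, T i k != 0.
Hypothesis T0E : forall i, T i 0 = 1.
Hypothesis TSE : forall i k, (0 < i)%N -> c i * T i k.+1 = c i + z * T i.+1 k.
Hypothesis a1E : a 1%N = z.
Hypothesis aE : forall i, (0 < i)%N -> a i.+1 = c i * z.
Hypothesis bE : forall i, (0 < i)%N -> b i = c i + z.

(* The recurrence solved for z, so that one substitution leaves a rational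
   identity in independent quantities. *)
Let zE i k : (0 < i)%N -> z = c i * (T i k.+1 - 1) / T i.+1 k.
Proof. by move=> i_gt0; rewrite mulrBr TSE // mulr1 addrC addKr mulfK. Qed.

(** By induction on the length k.  The fraction subtracted from c_i + z is
    c_i z T_(i+2,k) / (c_(i+1) T_(i+1,k+1)), where the recurrence at i+1 turns
    z T_(i+2,k) / c_(i+1) into T_(i+1,k+1) - 1; what is left is
    z + c_i / T_(i+1,k+1), which is the recurrence at i. *)
Lemma cfrac_tail i k : (0 < i)%N ->
  b i - cfrac a b i.+1 k = c i * T i k.+1 / T i.+1 k.
Proof.
elim: k i => [|k IHk] i i_gt0; rewrite bE // TSE //=.
  by rewrite T0E divr1 mulr1 subr0.
rewrite IHk // aE //.
rewrite -addrA mulrDl mulfK // [RHS]addrC [LHS]addrCA; congr (z + _).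
rewrite [in X in _ - X](zE i.+1 k) //.
by field; rewrite !T_neq0 c_neq0.
Qed.

(** The level-1 numerator is z and not c_0 z, so the recurrence at level 1
    collapses the fraction to (T_(1,j) - 1) / T_(1,j). *)
Lemma one_sub_cfrac j : 1 - cfrac a b 1 j = (T 1 j)^-1.
Proof.
case: j => [|k]; first by rewrite T0E invr1 subr0.
rewrite /= cfrac_tail // a1E [in X in _ - X](zE 1 k) //.
by field; rewrite !T_neq0 c_neq0.
Qed.

End EulerContinuedFraction.

Section HornerSum.
Variables (K : fieldType) (c : nat -> K).

(** The sum of 'X^(2n) / (c_i ... c_(i+n-1)) over n <= k, in Horner form: this
    matches the nesting of the continued fraction. *)
Fixpoint horner_sum (i k : nat) : {poly K} :=
  if k is k'.+1 then 1 + (c i)^-1 *: ('X^2 * horner_sum i.+1 k') else 1.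

(** The range goes one degree beyond 2k because the sum is even. *)
Lemma coef_horner_sum i k m : (m <= k.*2.+1)%N ->
  (horner_sum i k)`_m =
    if odd m then 0 else (\prod_(i <= l < i + m./2) c l)^-1.
Proof.
elim: k i m => [|k IHk] i [|[|m]] //= le_mk.
- by rewrite coef1 addn0 big_geq ?invr1.
- by rewrite coef1.
- by rewrite coefD coefZ coefXnM coef1 mulr0 addr0 addn0 big_geq ?invr1.
- by rewrite coefD coefZ coefXnM coef1 mulr0 addr0.
rewrite coefD coefZ coefXnM coef1 /= add0r subn2 /= negbK.
rewrite IHk; last by rewrite doubleS in le_mk.
case: ifP => _; first by rewrite mulr0.
by rewrite addnS -addSn [in RHS]big_ltn ?leq_addr // invfM.
Qed.

Lemma horner_sum_at0 i k : (horner_sum i k).[0] = 1.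
Proof. by rewrite horner_coef0 coef_horner_sum //= addn0 big_geq ?invr1. Qed.

Lemma tofrac_horner_sum_neq0 i k : tofrac (horner_sum i k) != 0.
Proof.
rewrite tofrac_eq0; apply: contra_eq_neq (horner_sum_at0 i k) => ->.
by rewrite horner0 eq_sym oner_neq0.
Qed.

Lemma tofrac_horner_sumS i k : c i != 0 ->
  tofrac (c i)%:P * tofrac (horner_sum i k.+1) =
    tofrac (c i)%:P + tofrac 'X^2 * tofrac (horner_sum i.+1 k).
Proof.
move=> ci; rewrite -!tofracM -tofracD; congr tofrac.
by rewrite /= -mul_polyC mulrDr mulr1 mulrA -polyCM divff // mul1r.
Qed.

End HornerSum.

Lemma qnat_neq0 (K : fieldType) (q : K) n :
  q != 1 -> ~~ root_of_unity n q -> qnat q n != 0.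
Proof.
move=> q1; rewrite unity_rootE => qn.
by rewrite mulf_neq0 ?invr_neq0 // subr_eq0 eq_sym.
Qed.

Lemma qfact_ratio (K : fieldType) (q : K) N n :
  (forall m, (0 < m)%N -> qnat q m != 0) ->
  qfact q (2 * N + 1) / qfact q (2 * N + 2 * n + 1) =
    (\prod_(1 <= l < 1 + n) cf_coef q N l)^-1.
Proof.
move=> q_neq0; have qfact_neq0 m : qfact q m != 0.
  rewrite /qfact prodf_seq_neq0; apply/allP => i.
  by rewrite mem_index_iota => /andP[i_gt0 _]; apply: q_neq0.
have prod_neq0 m : \prod_(1 <= l < 1 + m) cf_coef q N l != 0.
  rewrite prodf_seq_neq0; apply/allP => i.
  rewrite mem_index_iota => /andP[i_gt0 _].
  by rewrite mulf_neq0 ?q_neq0 //; lia.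
suff -> : qfact q (2 * N + 2 * n + 1) =
    qfact q (2 * N + 1) * \prod_(1 <= l < 1 + n) cf_coef q N l.
  by field; rewrite prod_neq0 qfact_neq0.
elim: n => [|n IHn]; first by rewrite big_geq // mulr1 muln0 addn0.
rewrite (addnS 1) big_nat_recr // mulrA -IHn.
have -> : (2 * N + 2 * n.+1 + 1 = (2 * N + 2 * n + 1).+2)%N by lia.
rewrite /qfact 2?big_nat_recr //= -mulrA /cf_coef.
by congr (_ * (qnat _ _ * qnat _ _)); lia.
Qed.

Theorem theorem9 (R : realType) (q : R[i]) (N : nat)
    (q_neq1 : q != 1)
    (q_not_unity : forall n : nat, (0 < n)%N -> ~~ root_of_unity n q) :
  exists e : nat -> fps R[i],
    (forall j, expansion_at0 (cf_trunc q N j) (e j)) /\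
    xadic_cvg e (egf (qhyp_euler2 q N)).
Proof.
have q_neq0 m : (0 < m)%N -> qnat q m != 0.
  by move=> m_gt0; rewrite qnat_neq0 ?q_not_unity.
have c_neq0 i : (0 < i)%N -> cf_coef q N i != 0.
  by move=> i_gt0; rewrite mulf_neq0 ?q_neq0 //; lia.
exists (fun j => fps_inv (fps_of_poly (horner_sum _ (cf_coef q N) 1 j))).
split=> [j | m].
  pose T i k := tofrac (horner_sum _ (cf_coef q N) i k).
  rewrite /cf_trunc (@one_sub_cfrac _ (tofrac 'X^2)
    (fun i => tofrac (cf_coef q N i)%:P) _ _ T) //.
  - by apply: expansion_at0_inv; rewrite horner_sum_at0 oner_neq0.
  - by move=> i i_gt0; rewrite tofrac_eq0 polyC_eq0 c_neq0.
  - by move=> i k; apply: tofrac_horner_sum_neq0.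
  - by move=> i k i_gt0; apply: tofrac_horner_sumS; apply: c_neq0.
  - by case=> // i _; rewrite -tofracM.
  - by move=> i _; rewrite -tofracD.
(* Agreement holds up to degree 2j+1, hence below m as soon as j >= m. *)
exists m => j le_mj k lt_km; rewrite egf_qhyp_euler2.
apply: eq_fps_inv => l le_lk.
rewrite /fps_of_poly coef_horner_sum; last by lia.
by rewrite /qhyp_series qfact_ratio.
Qed.
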